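(* Work in a classical and impredicative setting. Let $\mathcal B,\mathcal B'$ be Boolean algebras, regarded as oo-lattices with $p\bowtie q:\iff p\wedge q\ne0$. A map $f:\mathcal B\to\mathcal B'$ is a morphism of oo-lattices if and only if it preserves all joins which exist in the domain, i.e. whenever a family $(p_i)_{i\in I}$ in $\mathcal B$ has a join $\bigvee_{i\in I}p_i$ in $\mathcal B$, the element $f(\bigvee_{i\in I}p_i)$ is the join of the family $(f(p_i))_{i\in I}$ in $\mathcal B'$.
   Context: An overlap lattice with opposite (oo-lattice) is a quadruple $(\mathcal P,\le,\bowtie,-)$ where $(\mathcal P,\le)$ is a bounded lattice (with bottom $0$ and top $1$), $-$ is a pseudo-complement operation ($p\wedge q=0\iff p\le -q$) and $\bowtie$ is a binary relation on $\mathcal P$ such that for all $p,q$: (symmetry) $p\bowtie q\Rightarrow q\bowtie p$; (meet closure) $p\bowtie q\Rightarrow p\bowtie(p\wedge q)$; (splitting of existing joins) whenever $(q_i)_{i\in I}$ is a set-indexed family whose join $\bigvee_{i\in I}q_i$ exists, $p\bowtie\bigvee_{i\in I}q_i\iff(\exists i\in I)(p\bowtie q_i)$; (density) $(\forall r\in\mathcal P)(r\bowtie p\Rightarrow r\bowtie q)\Rightarrow p\le q$. All oo-lattices are assumed set-based: there is a set $S$ of elements (a base) such that for every $p$ the join of $\{a\in S\mid a\le p\}$ exists and equals $p$. Classically, oo-lattices are exactly Boolean algebras, with $\bowtie$ given by $p\wedge q\neq 0$. A morphism of oo-lattices from $\mathcal P$, with base $S$, to $\mathcal Q$ is a map $f:\mathcal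 P\to\mathcal Q$ such that for all $p\in\mathcal P$, $q\in\mathcal Q$: $f(p)\bowtie q\iff(\exists a\in S)\big(p\bowtie a\ \text{and}\ (\forall x\in S)(x\bowtie a\Rightarrow f(x)\bowtie q)\big)$. *)

(* Defs.v *)
From mathcomp Require Import all_boot all_order.
From mathcomp Require Import boolp classical_sets.

Set Implicit Arguments.
Unset Strict Implicit.
Unset Printing Implicit Defensive.

Import Order.Theory.
Local Open Scope classical_set_scope.
Local Open Scope order_scope.

(* The join of a given family need not exist, hence the relational form:
   [is_join q j] reads "the join of the family q exists and equals j". *)
Definition is_join d (P : porderType d) (I : Type) (q : I -> P) (j : P) : Prop :=
  isLub (range q) j.

Definition is_base d (P : porderType d) (S : set P) : Prop :=
  forall p : P, isLub [set a | S a /\ a <= p] p.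

Record ooLattice d := OOLattice {
  oo_carrier :> tbLatticeType d;
  oo_opp : oo_carrier -> oo_carrier;
  oo_overlap : oo_carrier -> oo_carrier -> Prop;
  oo_oppP : forall p q, Order.meet p q = \bot <-> p <= oo_opp q;
  oo_sym : forall p q, oo_overlap p q -> oo_overlap q p;
  oo_meet_closure : forall p q,
    oo_overlap p q -> oo_overlap p (Order.meet p q);
  oo_splitting : forall p (I : Type) (q : I -> oo_carrier) j,
    is_join q j -> oo_overlap p j <-> exists i, oo_overlap p (q i);
  oo_density : forall p q,
    (forall r, oo_overlap r p -> oo_overlap r q) -> p <= q;
  oo_set_based : exists S : set oo_carrier, is_base S
}.

Arguments oo_overlap {d o} _ _.

(* The defining condition mentions a base [S] of the domain only. *)
Definition oo_morphism d d' (P : ooLattice d) (Q : ooLattice d')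
    (S : set P) (f : P -> Q) : Prop :=
  forall (p : P) (q : Q),
    oo_overlap (f p) q <->
    exists a : P, [/\ S a, oo_overlap p a &
      forall x : P, S x -> oo_overlap x a -> oo_overlap (f x) q].

Arguments oo_morphism {d d'} P Q S f.

Definition preserves_joins d d' (P : porderType d) (Q : porderType d')
    (f : P -> Q) : Prop :=
  forall (I : Type) (p : I -> P) (j : P),
    is_join p j -> is_join (fun i => f (p i)) (f j).

Section BooleanAlgebra.
Context d (B : ctbDistrLatticeType d).
Implicit Types p q r : B.

Definition bool_overlap p q : Prop := Order.meet p q <> \bot.

Lemma bool_oppP p q : Order.meet p q = \bot <-> p <= Order.compl q.
Proof. by rewrite -disj_leC; split=> [->|/eqP]. Qed.

Lemma bool_sym p q : bool_overlap p q -> bool_overlap q p.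
Proof. by rewrite /bool_overlap meetC. Qed.

Lemma bool_meet_closure p q :
  bool_overlap p q -> bool_overlap p (Order.meet p q).
Proof. by rewrite /bool_overlap meetA meetxx. Qed.

Lemma bool_splitting p (I : Type) (q : I -> B) j :
  is_join q j -> bool_overlap p j <-> exists i, bool_overlap p (q i).
Proof.
move=> [ubj lubj]; split=> [pj|[i pqi] pj0].
  apply: contrapT => /forallNP npq; apply: pj; rewrite meetC.
  apply/bool_oppP; apply: lubj => _ [i _ <-]; apply/bool_oppP.
  by rewrite meetC; apply: contrapT; exact: npq.
apply: pqi; apply/eqP; rewrite -lex0 -pj0 leI2 //.
by apply: ubj; exists i.
Qed.

Lemma bool_density p q :
  (forall r, bool_overlap r p -> bool_overlap r q) -> p <= q.
Proof.
move=> pq; rewrite -[q]complK; apply/bool_oppP; apply: contrapT.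
by rewrite meetC => /pq; rewrite /bool_overlap meetCx.
Qed.

Lemma bool_set_based : exists S : set B, is_base S.
Proof. by exists setT => p; split=> [a []//|b]; apply. Qed.

Definition bool_ooLattice : ooLattice d :=
  OOLattice bool_oppP bool_sym bool_meet_closure bool_splitting bool_density
    bool_set_based.

End BooleanAlgebra.

(* Main.v *)
Require Import Defs.
From mathcomp Require Import all_boot all_order.
From mathcomp Require Import boolp classical_sets.

(** Call [x] negligible when [f x] misses [q].  If a join-preserving [f] did not
satisfy the morphism condition at [(p, q)], every base element overlapping [p]
would overlap a negligible base element; by density [p] would be the join of the
meets [p /\ x] with [x] negligible, so that [f p] itself would miss [q].  The
converse is the splitting of joins in the domain and density in the codomain. *)

Set Implicit Arguments.
Unset Strict Implicit.
Unset Printing Implicit Defensive.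

Import Order.Theory.
Local Open Scope classical_set_scope.
Local Open Scope order_scope.

(** Bridges [is_base], which speaks of subsets, and [bool_splitting], which speaks of indexed
    families. *)
Lemma is_join_set d (P : porderType d) (A : set P) (j : P) :
  isLub A j -> is_join (fun x : {x | A x} => sval x) j.
Proof.
move=> [ubj lubj]; split=> [_ [[x Ax] _ <-]|u ubu]; first exact: ubj.
by apply: lubj => x Ax; apply: ubu; exists (exist _ x Ax).
Qed.

(** If [x <= y], then [y] is the join of the two-element family of [x] and [y]. *)
Lemma preserves_joins_le d d' (P : porderType d) (Q : porderType d')
    (f : P -> Q) :
  preserves_joins f -> {homo f : x y / x <= y}.
Proof.
move=> fJ x y xy.
have jy : is_join (fun b : bool => if b then x else y) y.
  by split=> [_ [[] _ <-]//|u]; apply; exists false.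
by have [ub _] := fJ _ _ _ jy; apply: ub; exists true.
Qed.

Lemma bool_overlapS d (B : ctbDistrLatticeType d) (x y q : B) :
  x <= y -> bool_overlap x q -> bool_overlap y q.
Proof.
by move=> xy xq yq0; apply: xq; apply/eqP; rewrite -lex0 -yq0 leI2.
Qed.

(** A witness [a] for [x] also serves for [y]: the point enters the morphism condition only through
    its overlap with [a]. *)
Lemma oo_morphism_le d d' (P : ctbDistrLatticeType d) (Q : ooLattice d')
    (S : set P) (f : P -> Q) :
  oo_morphism (bool_ooLattice P) Q S f -> {homo f : x y / x <= y}.
Proof.
move=> fM x y xy; apply: oo_density => r /oo_sym /fM [a [Sa xa aq]].
by apply/oo_sym/fM; exists a; split=> //; apply: bool_overlapS xa.
Qed.

Lemma oo_morphism_preserves_joins d d' (P : ctbDistrLatticeType d)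
    (Q : ctbDistrLatticeType d') (S : set P) (f : P -> Q) :
  oo_morphism (bool_ooLattice P) (bool_ooLattice Q) S f -> preserves_joins f.
Proof.
move=> fM I p j jp; split=> [_ [i _ <-]|u ubu].
  by apply: (oo_morphism_le fM); case: jp => ubj _; apply: ubj; exists i.
apply: bool_density => q /bool_sym /fM [a [Sa /bool_sym ja aq]].
(* Splitting moves the overlap with [a] from [j] to some [p i], so the same [a] is a witness for
   [p i]. *)
have [i /bool_sym pia] := (bool_splitting a jp).1 ja.
apply: bool_sym; apply: (bool_overlapS (x := f (p i))).
  by apply: ubu; exists i.
by apply/fM; exists a.
Qed.

Lemma is_base_neq0 d (B : ctbDistrLatticeType d) (S : set B) (p : B) :
  is_base S -> p <> \bot -> exists a, [/\ S a, a <= p & a <> \bot].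
Proof.
move=> hS p0; apply: contrapT => no; apply: p0; apply/eqP; rewrite -lex0.
apply: (hS p).2 => a [Sa ap]; rewrite lex0; apply/eqP.
by apply: contrapT => a0; apply: no; exists a.
Qed.

Lemma preserves_joins_oo_morphism d d' (B : ctbDistrLatticeType d)
    (B' : ctbDistrLatticeType d') (S : set B) (f : B -> B') :
  is_base S -> preserves_joins f ->
  oo_morphism (bool_ooLattice B) (bool_ooLattice B') S f.
Proof.
move=> hS fJ p q; have fle := preserves_joins_le fJ; split; last first.
  (* As [p] is the join of the base elements below it, one of them overlaps [a]; monotonicity then
     passes from it to [p]. *)
  move=> [a [_ /bool_sym pa aq]].
  have [[x [Sx xp]] /= /bool_sym xa] :=
    (bool_splitting a (is_join_set (hS p))).1 pa.
  exact: bool_overlapS (fle _ _ xp) (aq _ Sx xa).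
move=> /bool_sym fpq; apply: contrapT => /forallNP no.
pose N := {x | S x /\ ~ bool_overlap (f x) q}.
have jp : is_join (fun x : N => Order.meet p (sval x)) p.
  split=> [_ [x _ <-]|u ubu]; first exact: leIl.
  (* If [p <= u] failed, a nonzero base element [a] would lie below both [p] and the complement of
     [u]; it is shown to be the witness excluded by [no]. *)
  rewrite -[u]complK; apply/bool_oppP; apply: contrapT.
  move=> /(is_base_neq0 hS) [a [Sa]]; rewrite lexI => /andP[ap au] a0.
  apply: (no a); split=> //.
    by rewrite /= /bool_overlap; move/meet_idPr: ap => ->.
  move=> x Sx xa; apply: contrapT => xq; apply: xa.
  (* For negligible [x], the meet of [x] and [a] lies below both [u] and its complement, hence is
     zero. *)
  have xu : Order.meet p x <= u by apply: ubu; exists (exist _ x (conj Sx xq)).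
  apply/eqP; rewrite -lex0 -(meetxC u) lexI; apply/andP; split.
    by apply: le_trans xu; rewrite lexI leIl (le_trans _ ap) ?leIr.
  by rewrite (le_trans _ au) ?leIr.
have [[x [Sx xq]] /= /bool_sym pxq] := (bool_splitting q (fJ _ _ _ jp)).1 fpq.
by apply: xq; apply: bool_overlapS pxq; apply: fle; exact: leIr.
Qed.

Theorem proposition4p10 (d d' : Order.disp_t)
    (B : ctbDistrLatticeType d) (B' : ctbDistrLatticeType d')
    (S : set B) (hS : is_base S) (f : B -> B') :
  oo_morphism (bool_ooLattice B) (bool_ooLattice B') S f
  <-> preserves_joins f.
Proof.
split; first exact: oo_morphism_preserves_joins.
exact: preserves_joins_oo_morphism.
Qed.
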